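(* Let $\pi:\Omega\to\Sigma$ be a surjective $1$-block factor map between irreducible subshifts of finite type $\Omega\subset\mathcal{A}^{\mathbb{Z}_+}$ and $\Sigma\subset\mathcal{B}^{\mathbb{Z}_+}$. Let $P$ be an irreducible stochastic matrix compatible with $\Omega$, let $p$ be its invariant distribution ($pP=p$), and let $\mu$ be the corresponding stationary Markov measure on $\Omega$. Let $\{\mu_y\}_{y\in\Sigma}$ be a disintegration of $\mu$ with respect to $\pi$. Then $\nu=\mu\circ\pi^{-1}$ is consistent with the positive measurable normalized function $\tilde g:\Sigma\to(0,1)$, i.e. $$\nu(y_0\mid y_1,y_2,\ldots)=\tilde g(y)\quad\nu\text{-a.e.},$$ where, for $y=(y_0,y_1,\ldots)\in\Sigma$, $$\tilde g(y)=\int_{\Omega_{Ty}}\Bigl[\sum_{a\in\pi^{-1}(y_0)}\frac{p_aP_{a,x_0}}{p_{x_0}}\Bigr]\mu_{Ty}(dx)=\sum_{a'\in\pi^{-1}(y_1)}\Bigl[\sum_{a\in\pi^{-1}(y_0)}\frac{p_aP_{a,a'}}{p_{a'}}\Bigr]\mu_{Ty}\bigl(\{w\in\Omega:w_0=a'\}\bigr).$$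
   Context: $\mathbb{Z}_+=\{0,1,2,\ldots\}$. $\mathcal{A},\mathcal{B}$ are finite sets with $|\mathcal{A}|>|\mathcal{B}|$ and $\pi:\mathcal{A}\to\mathcal{B}$ is surjective; the same symbol denotes the induced map $\pi:\mathcal{A}^{\mathbb{Z}_+}\to\mathcal{B}^{\mathbb{Z}_+}$, $\pi(x)_n=\pi(x_n)$ (a $1$-block factor map), and its restriction $\Omega\to\Sigma=\pi(\Omega)$. For a $0/1$ matrix $M$ indexed by $\mathcal{A}\times\mathcal{A}$, the subshift of finite type (SFT) is $\Omega_M=\{x\in\mathcal{A}^{\mathbb{Z}_+}:M(x_n,x_{n+1})=1\ \forall n\ge0\}$ with the product topology; it is irreducible if for all $i,j$ there is $n>0$ with $M^n(i,j)>0$. Here $\Omega=\Omega_M$ and $\Sigma=\Sigma_{M'}$ for a $0/1$ matrix $M'$ indexed by $\mathcal{B}\times\mathcal{B}$. A stochastic matrix $P$ is compatible with $\Omega_M$ if $P_{ij}>0\iff M(i,j)=1$. $T:\Sigma\to\Sigma$ is the left shift, $Ty=(y_1,y_2,\ldots)$; $by$ denotes the sequence $(b,y_0,y_1,\ldots)$. The fibre over $y\in\Sigma$ is $\Omega_y=\{x\in\Omega:\pi(x)=y\}$. A function $\tilde g$ on $\Sigma$ is normalized if $\sum_{b\in\mathcal{B}:\,by\in\Sigma}\tilde g(by)=1$ for all $y\in\Sigma$. A disintegration of $\mu$ with respect to $\pi$ is a family $\{\mu_y\}_{y\in\Sigma}$ where each $\mu_y$ is a Borel probability measure on $\Omega_y$,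 $\mu_y(\Omega_y)=1$, such that for all $f\in L^1(\Omega,\mu)$ the map $y\mapsto\int_{\Omega_y}f(x)\,\mu_y(dx)$ is measurable and $\int_\Omega f(x)\,\mu(dx)=\int_\Sigma\int_{\Omega_y}f(x)\,\mu_y(dx)\,\nu(dy)$. $\nu(y_0\mid y_1,y_2,\ldots)$ denotes the conditional probability under $\nu$ that the $0$-th coordinate equals $y_0$, given the coordinates $y_1,y_2,\ldots$.
   Formalization: The range (0,1) fails in general (g̃=1 if |B|=1; g̃ may be 0 at some y as μ_y is arbitrary on ν-null sets); proved instead: 0≤g̃≤1 on Σ, g̃>0 ν-a.e., and g̃(y)>0 (resp. <1) iff μ_{Ty} charges the x having a predecessor in (resp. outside) π⁻¹(y_0). *)

(* Defs.v *)
From HB Require Import structures.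
From mathcomp Require Import all_boot all_order all_algebra.
From mathcomp Require Import all_classical all_reals all_analysis.
From mathcomp Require Import measurable_realfun.

Set Implicit Arguments.
Unset Strict Implicit.
Unset Printing Implicit Defensive.

Import Order.TTheory GRing.Theory Num.Theory.
Import numFieldNormedType.Exports.

Local Open Scope classical_set_scope.
Local Open Scope ring_scope.

(* Nonempty finite alphabets. The distinguished point is used only because
   measurable types are pointed. *)
#[short(type="pointedFinType")]
HB.structure Definition PointedFinite := {T of Finite T & Pointed T}.

(* A^Z_+ with the Borel sigma-algebra of the product of discrete topologies. *)
Definition symseq (A : pointedFinType) :=
  g_sigma_algebraType
    (open : set (set (prod_topology (fun _ : nat => discrete_topology A)))).

Section Sequences.
Context {A B : pointedFinType}.

Definition left_shift (x : symseq A) : symseq A := fun n => x n.+1.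

Definition scons (a : A) (x : symseq A) : symseq A :=
  fun n => if n is k.+1 then x k else a.

Definition blockmap (pi : A -> B) (x : symseq A) : symseq B :=
  fun n => pi (x n).

Definition SFT (M : A -> A -> bool) : set (symseq A) :=
  [set x | forall n, M (x n) (x n.+1)].

Definition fibre (pi : A -> B) (Omega : set (symseq A)) (y : symseq B) :
    set (symseq A) :=
  [set x | Omega x /\ blockmap pi x = y].

End Sequences.

Definition to_mx {S : Type} {A : finType} (Q : A -> A -> S) : 'M[S]_#|A| :=
  \matrix_(i, j) Q (enum_val i) (enum_val j).

Definition irreducible_matrix {S : numDomainType} {A : finType}
    (Q : A -> A -> S) : Prop :=
  forall i j : A, exists2 n : nat,
    (0 < n)%N & 0 < (to_mx Q ^+ n) (enum_rank i) (enum_rank j).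

Definition irreducible_SFT {A : finType} (M : A -> A -> bool) : Prop :=
  irreducible_matrix (fun i j => (M i j)%:R : int).

Section Markov.
Context {R : realType} {A : pointedFinType}.

Definition distribution_vector (p : A -> R) : Prop :=
  (forall a, 0 <= p a) /\ \sum_a p a = 1.

Definition stochastic_matrix (P : A -> A -> R) : Prop :=
  forall i, (forall j, 0 <= P i j) /\ \sum_j P i j = 1.

Definition compatible (P : A -> A -> R) (M : A -> A -> bool) : Prop :=
  forall i j, 0 < P i j <-> M i j.

Definition invariant_vector (p : A -> R) (P : A -> A -> R) : Prop :=
  forall j, \sum_i p i * P i j = p j.

Definition markov_measure (p : A -> R) (P : A -> A -> R)
    (mu : probability (symseq A) R) : Prop :=
  forall (n : nat) (w : nat -> A),
    mu [set x : symseq A | forall i, (i <= n)%N -> x i = w i] =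
    (p (w 0%N) * \prod_(i < n) P (w i) (w i.+1))%:E.

End Markov.

Section Factor.
Context {R : realType} {A B : pointedFinType}.

(* The measures live on the full sequence spaces; [mu_ y] is constrained only
   for [y] in [Sigma]. *)
Definition disintegration (pi : A -> B)
    (Omega : set (symseq A)) (Sigma : set (symseq B))
    (mu : probability (symseq A) R) (nu : probability (symseq B) R)
    (mu_ : symseq B -> probability (symseq A) R) : Prop :=
  (forall y, Sigma y -> mu_ y (fibre pi Omega y) = 1%E) /\
  (forall f : symseq A -> R, mu.-integrable Omega (EFin \o f) ->
    measurable_fun Sigma
      (fun y => (\int[mu_ y]_(x in fibre pi Omega y) (f x)%:E)%E) /\
    (\int[mu]_(x in Omega) (f x)%:E =
     \int[nu]_(y in Sigma) \int[mu_ y]_(x in fibre pi Omega y) (f x)%:E)%E).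

Definition gtilde (pi : A -> B) (Omega : set (symseq A))
    (p : A -> R) (P : A -> A -> R)
    (mu_ : symseq B -> probability (symseq A) R) (y : symseq B) : R :=
  \int[mu_ (left_shift y)]_(x in fibre pi Omega (left_shift y))
    (\sum_(a | pi a == y 0%N) p a * P a (x 0%N) / p (x 0%N)).

End Factor.

Section Consistency.
Context {R : realType} {B : pointedFinType}.

Definition normalized (Sigma : set (symseq B)) (g : symseq B -> R) : Prop :=
  forall y, Sigma y ->
    \sum_(b : B | `[< Sigma (scons b y) >]) g (scons b y) = 1.

(* The sigma-algebra generated by (y_1, y_2, ...). *)
Definition future_sigma : set (set (symseq B)) :=
  preimage_set_system setT (@left_shift B) measurable.

(* [h b] is a version of the conditional probability of {y_0 = b} given
   (y_1, y_2, ...). *)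
Definition conditional_probability (nu : probability (symseq B) R)
    (h : B -> symseq B -> R) : Prop :=
  forall b,
    [/\ (forall U : set R, measurable U -> future_sigma (h b @^-1` U)),
        nu.-integrable setT (EFin \o h b) &
        forall C, future_sigma C ->
          (\int[nu]_(y in C) (h b y)%:E)%E =
          nu ([set y : symseq B | y 0%N = b] `&` C)].

(* nu(y_0 | y_1, y_2, ...) = g(y) nu-a.e.: such conditional probabilities exist
   and each version satisfies the equation. *)
Definition consistent (nu : probability (symseq B) R) (g : symseq B -> R) :
    Prop :=
  (exists h, conditional_probability nu h) /\
  (forall h, conditional_probability nu h ->
    {ae nu, forall y, h (y 0%N) y = g y}).

End Consistency.

(* Main.v *)
Require Import Defs.
From HB Require Import structures.
From mathcomp Require Import all_boot all_order all_algebra.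
From mathcomp Require Import all_classical all_reals all_analysis.
From mathcomp Require Import measurable_realfun.

Set Implicit Arguments.
Unset Strict Implicit.
Unset Printing Implicit Defensive.

Import Order.TTheory GRing.Theory Num.Theory.
Import numFieldNormedType.Exports.

Local Open Scope classical_set_scope.
Local Open Scope ring_scope.

(* Reversing the Markov chain, the Markov property reads
     mu (x_0 \in Q, T x \in E) = \int_E w_Q (x_0) dmu,
   where w_Q a' = \sum_(a in Q) p_a P_(a,a') / p_a' ; both sides are measures in
   E, and they agree on cylinders. Applying this to Q = pi^-1(b) and
   E = pi^-1(D), and disintegrating the right-hand side along pi, gives
     nu (y_0 = b, T y \in D) = \int_D (\int w_Q (x_0) mu_y(dx)) nu(dy),
   and the inner integral at y is gtilde (b y). As nu is T-invariant, this says
   that gtilde (b (T y)) is a conditional probability of {y_0 = b} given the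
   future. Normalization and the bounds come from w being additive in Q with
   w_A = 1, by the invariance of p. *)

(** * Cylinder sets and the Borel structure of the sequence space *)

Section Cylinders.
Context {A : pointedFinType}.

Definition cylinder (n : nat) (w : nat -> A) : set (symseq A) :=
  [set x | forall i, (i < n)%N -> x i = w i].

Lemma cylinder0 (w : nat -> A) : cylinder 0 w = setT.
Proof. by apply/seteqP; split. Qed.

Lemma measurable_coord (n : nat) (a : A) :
  measurable [set x : symseq A | x n = a].
Proof.
apply: sub_sigma_algebra.
have /(@continuousP (prod_topology (fun=> discrete_topology A))) cont :=
  @proj_continuous nat (fun=> discrete_topology A) n.
exact: cont [set a] (discrete_open _).
Qed.

Lemma measurable_coord_pred (n : nat) (Q : A -> Prop) :
  measurable [set x : symseq A | Q (x n)].
Proof.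
rewrite (_ : [set x | _] = \bigcup_(a in Q) [set x : symseq A | x n = a]).
  apply: fin_bigcup_measurable => [|a _]; first exact: finite_finset.
  exact: measurable_coord.
apply/seteqP; split=> [x Qx|x [a Qa xa]]; first by exists (x n).
by rewrite /= xa.
Qed.

Lemma measurable_cylinder (n : nat) (w : nat -> A) : measurable (cylinder n w).
Proof.
rewrite (_ : cylinder n w =
    \bigcap_(i in `I_n) [set x : symseq A | x i = w i]).
  by apply: bigcap_measurableType => i _; exact: measurable_coord.
by apply/seteqP; split.
Qed.

Lemma cylinder_nbhs (x : symseq A) (U : set (symseq A)) :
  @open (prod_topology (fun=> discrete_topology A)) U -> U x ->
  exists n, cylinder n x `<=` U.
Proof.
move=> oU Ux.
(* Each coordinate is eventually fixed along the cylinders around [x], so they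
   generate a filter that converges to [x]. *)
have Fdir : Filter (filter_from [set: nat] (cylinder^~ x)).
  apply: filter_from_filter; first by exists 0%N.
  move=> i j _ _; exists (maxn i j) => // y cy.
  by split=> k lek; apply: cy; rewrite leq_max lek ?orbT.
have : filter_from [set: nat] (cylinder^~ x) -->
    (x : prod_topology (fun=> discrete_topology A)).
  apply/cvg_sup => i; move=> V /= [W [[Z oZ <-] Zx] WV].
  exists i.+1 => // y cy; apply: WV => /=.
  by rewrite /= (cy i)//.
by move=> /(_ U) []; [exact: open_nbhs_nbhs|move=> n _; exists n].
Qed.

(** The empty set is included because two cylinders may be disjoint and the family has to be closed
    under intersection. *)
Definition cylinders : set (set (symseq A)) :=
  [set C | C = set0 \/ exists n w, C = cylinder n w].

Lemma setI_closed_cylinders : setI_closed cylinders.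
Proof.
move=> C D [->|[n [v ->]]]; first by left; rewrite set0I.
move=> [->|[m [w ->]]]; first by left; rewrite setI0.
have [->|/set0P[x [xv xw]]] := eqVneq (cylinder n v `&` cylinder m w) set0.
  by left.
(* Any common point [x] spells a word extending both [v] up to [n] and [w] up to [m]. *)
right; exists (maxn n m), x; apply/seteqP; split=> y.
  move=> [yv yw] i; rewrite leq_max => /orP[ilt|ilt].
    by rewrite yv// xv.
  by rewrite yw// xw.
move=> yx; split=> i ilt; rewrite yx ?leq_max ?ilt ?orbT//.
  exact: xv.
exact: xw.
Qed.

(** An open set is the union of the cylinders it contains, and there are only countably many
    cylinders. *)
Lemma measurable_cylindersE :
  @measurable _ (symseq A) = <<s cylinders >>.
Proof.
apply/seteqP; split; last first.
  apply: smallest_sub; first exact: sigma_algebra_measurable.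
  by move=> _ [->|[n [w ->]]]; [exact: measurable0|exact: measurable_cylinder].
apply: smallest_sub; first exact: smallest_sigma_algebra.
move=> U oU.
(* Indexing by finite lists instead of functions on [nat] makes the union countable. The default
   value of [nth] is never read, since only indices below [size s] matter. *)
have -> : U = \bigcup_(s in [set s : seq A |
      cylinder (size s) (nth point s) `<=` U]) cylinder (size s) (nth point s).
  apply/seteqP; split=> [x Ux|x [s sU /sU//]].
  have [n nU] := cylinder_nbhs oU Ux.
  have cE : cylinder (size (mkseq x n)) (nth point (mkseq x n)) = cylinder n x.
    rewrite size_mkseq; apply/seteqP.
    by split=> y yx i ilt; move: (yx i ilt); rewrite nth_mkseq.
  by exists (mkseq x n) => /=; rewrite cE//.
rewrite bigcup_mkcond.
apply: (@countable_bigcupT_measurable _ (g_sigma_algebraType cylinders)).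
  exact: countableP.
move=> s; case: ifP => _; last exact: measurable0.
by apply: sub_sigma_algebra; right; exists (size s), (nth point s).
Qed.

Lemma measurable_fun_symseq d (T : measurableType d) (f : T -> symseq A) :
  (forall n a, measurable [set t | f t n = a]) -> measurable_fun setT f.
Proof.
move=> mf; apply: (measurability cylinders); first exact: measurable_cylindersE.
move=> _ [C [->|[n [w ->]]] <-].
  by rewrite preimage_set0 setI0; exact: measurable0.
rewrite setTI (_ : _ @^-1` _ = \bigcap_(i in `I_n) [set t | f t i = w i]).
  by apply: bigcap_measurableType => i _; exact: mf.
by apply/seteqP; split.
Qed.

(** The cylinders are an intersection-stable generating family that contains the whole space (length
    [0]), so a finite measure is determined by its values on them. *)
Lemma measure_cylinder_unique (R : realType)
    (m1 m2 : {measure set (symseq A) -> \bar R}) :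
  (m1 setT < +oo)%E -> (forall n w, m1 (cylinder n w) = m2 (cylinder n w)) ->
  forall E, measurable E -> m1 E = m2 E.
Proof.
move=> fin1 m12; apply: (@measure_unique _ _ _ cylinders (fun=> setT)).
- exact: measurable_cylindersE.
- exact: setI_closed_cylinders.
- by move=> _; right; exists 0%N, (fun=> point); rewrite cylinder0.
- by rewrite bigcup_const//; exists 0%N.
- by move=> _ [->|[n [w ->]]]; rewrite ?measure0.
- by [].
Qed.

Lemma measurable_left_shift : measurable_fun setT (@left_shift A).
Proof.
by apply: measurable_fun_symseq => n a; exact: (measurable_coord n.+1 a).
Qed.

Lemma measurable_preimage_left_shift (E : set (symseq A)) :
  measurable E -> measurable (@left_shift A @^-1` E).
Proof.
move=> mE; rewrite -[X in measurable X]setTI.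
exact: measurable_left_shift.
Qed.

Lemma measurable_SFT (M : A -> A -> bool) : measurable (SFT M).
Proof.
rewrite (_ : SFT M = \bigcap_n \bigcup_(a in setT)
    ([set x : symseq A | x n = a] `&` [set x | M a (x n.+1)])).
  apply: bigcapT_measurable => n.
  apply: fin_bigcup_measurable => [|a _]; first exact: finite_finset.
  apply: measurableI; first exact: measurable_coord.
  exact: (measurable_coord_pred n.+1 (fun b => M a b)).
apply/seteqP; split=> [x Mx n _|x Mx n].
  by exists (x n) => //; split=> //; exact: Mx.
by have [a _ []] := Mx n I => <-.
Qed.

Lemma SFT_left_shift (M : A -> A -> bool) y : SFT M y -> SFT M (left_shift y).
Proof. by move=> My n; exact: My. Qed.

End Cylinders.

(** * Measurability of the factor map and of its fibres *)

Section Factor.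
Context {A B : pointedFinType} (pi : A -> B).

Lemma measurable_blockmap : measurable_fun setT (blockmap pi).
Proof.
apply: measurable_fun_symseq => n b.
exact: (measurable_coord_pred n (fun a => pi a = b)).
Qed.

Lemma measurable_preimage_blockmap (E : set (symseq B)) :
  measurable E -> measurable (blockmap pi @^-1` E).
Proof.
move=> mE; rewrite -[X in measurable X]setTI.
exact: measurable_blockmap.
Qed.

Lemma measurable_fibre (M : A -> A -> bool) (y : symseq B) :
  measurable (fibre pi (SFT M) y).
Proof.
rewrite (_ : fibre _ _ _ =
    SFT M `&` \bigcap_n [set x : symseq A | pi (x n) = y n]).
  apply: measurableI; first exact: measurable_SFT.
  apply: bigcapT_measurable => n.
  exact: (measurable_coord_pred n (fun a => pi a = y n)).
apply/seteqP; split=> x [Mx xy]; split=> //.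
  by move=> n _; rewrite /= -xy.
by apply/funext => n; exact: (xy n).
Qed.

End Factor.

(** * Integrals of functions of a single coordinate *)

Section CoordinateIntegrals.
Context {R : realType} {A : pointedFinType}.

Lemma measurable_fun_coord (n : nat) (F : A -> R) (D : set (symseq A)) :
  measurable_fun D (fun x : symseq A => F (x n)).
Proof.
move=> mD Y _; apply: measurableI => //.
exact: (measurable_coord_pred n (fun a => Y (F a))).
Qed.

Context (m : probability (symseq A) R).

Lemma integrable_coord (n : nat) (F : A -> R) (D : set (symseq A)) :
  measurable D -> m.-integrable D (fun x => (F (x n))%:E).
Proof.
move=> mD; apply: measurable_bounded_integrable => //.
- by rewrite -ge0_fin_numE// fin_num_measure.
- exact: measurable_fun_coord.
(* The alphabet is finite, so this sum dominates every value of [F]. *)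
- exists (\sum_a `|F a|); split; first exact: num_real.
  move=> M /ltW leM x Dx /=; apply: le_trans leM.
  by rewrite (bigD1 (x n))//= lerDl sumr_ge0.
Qed.

(** [F (x n)] is a finite combination of indicators. Later integral identities thereby become
    identities between sums over letters. *)
Lemma integral_coord (n : nat) (F : A -> R) (D : set (symseq A)) :
  measurable D ->
  (\int[m]_(x in D) (F (x n))%:E =
   \sum_(a : A) (F a)%:E * m (D `&` [set x | x n = a]))%E.
Proof.
move=> mD.
have FE x : ((F (x n))%:E =
    \sum_(a : A) (F a)%:E * (\1_[set x : symseq A | x n = a] x)%:E)%E.
  rewrite (bigD1 (x n))//= indicE mem_set// mule1 big1 ?adde0// => a ax.
  by rewrite indicE memNset ?mule0// => /esym/eqP; rewrite (negbTE ax).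
under eq_integral do rewrite FE.
have mc a := @measurable_coord A n a.
have ic a : m.-integrable D
    (fun x => (\1_[set x : symseq A | x n = a] x)%:E).
  by apply: integrableS (integrable_indic m (mc a)).
rewrite integral_sum//; last by move=> a; exact: integrableZl.
apply: eq_bigr => a _.
by rewrite integralZl// integral_indic// setIC.
Qed.

Lemma measure_coord_pred (n : nat) (Q : pred A) (D : set (symseq A)) :
  measurable D ->
  (m (D `&` [set x | Q (x n)]) =
   \sum_(a | Q a) m (D `&` [set x | x n = a]))%E.
Proof.
move=> mD; have mQ := @measurable_coord_pred A n Q.
rewrite setIC -(integral_indic m mD mQ).
rewrite (_ : (fun x => _) = (fun x => ((Q (x n))%:R : R)%:E)); last first.
  apply/funext => x; rewrite indicE; congr (_%:R%:E).
  by congr (nat_of_bool _); apply/idP/idP => [/set_mem//|Qx]; exact/mem_set.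
rewrite (integral_coord n (fun a => (Q a)%:R))// [RHS]big_mkcond/=.
by apply: eq_bigr => a _; case: (Q a); rewrite ?mul1e ?mul0e.
Qed.

End CoordinateIntegrals.

Lemma psumr_gt0P (R : numDomainType) (I : finType) (Q : pred I) (F : I -> R) :
  (forall i, Q i -> 0 <= F i) ->
  0 < \sum_(i | Q i) F i <-> exists2 i, Q i & 0 < F i.
Proof.
move=> F0; split=> [|[i Qi Fi]]; last first.
  rewrite (bigD1 i)//= ltr_pwDl// sumr_ge0// => j /andP[Qj _].
  exact: F0.
rewrite lt_def => /andP[+ _]; rewrite psumr_neq0//.
by move=> /hasP[i _ /andP[Qi Fi]]; exists i.
Qed.

(** * Positivity of the invariant distribution *)

Section InvariantVector.
Context {R : realType} {A : pointedFinType}.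
Context (P : A -> A -> R) (p : A -> R).
Hypotheses (P_stoch : stochastic_matrix P) (P_irr : irreducible_matrix P).
Hypotheses (p_distr : distribution_vector p) (p_inv : invariant_vector p P).

Lemma to_mx_exp_ge0 n i j : 0 <= (to_mx P ^+ n) i j.
Proof.
elim: n i j => [|n IH] i j; first by rewrite expr0 mxE; case: eqP.
rewrite exprS mxE sumr_ge0// => k _; rewrite mulr_ge0// mxE.
by have [Pi0 _] := P_stoch (enum_val i); exact: Pi0.
Qed.

Lemma invariant_vector_exp n j :
  \sum_i p i * (to_mx P ^+ n) (enum_rank i) (enum_rank j) = p j.
Proof.
elim: n j => [|n IH] j.
  rewrite (bigD1 j)//= expr0 mxE eqxx mulr1 big1 ?addr0// => i ij.
  by rewrite mxE (inj_eq enum_rank_inj) (negbTE ij) mulr0.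
rewrite -(p_inv j); under eq_bigr do rewrite exprSr mxE mulr_sumr.
(* The matrix product sums over ordinals; [enum_rank] turns this index into a letter, where the
   induction hypothesis applies. *)
rewrite exchange_big (reindex (@enum_rank A))/=; last first.
  by apply: onW_bij; exact: enum_rank_bij.
apply: eq_bigr => k _; rewrite -(IH k) mulr_suml; apply: eq_bigr => i _.
by rewrite mxE !enum_rankK mulrA.
Qed.

(** Some [p i] is positive because the entries sum to [1]; irreducibility gives a positive entry of
    a power of [P] from [i] to [j], and [p] is invariant under that power. This legitimates the
    divisions by [p]. *)
Lemma invariant_vector_gt0 j : 0 < p j.
Proof.
have [p0 p1] := p_distr.
have [i _ pi] : exists2 i, xpredT i & 0 < p i.
  by apply/psumr_gt0P => //; rewrite p1.
have [n _ nij] := P_irr i j; rewrite -(invariant_vector_exp n j) (bigD1 i)//=.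
rewrite ltr_pwDl ?mulr_gt0// sumr_ge0// => k _; rewrite mulr_ge0//.
exact: to_mx_exp_ge0.
Qed.

End InvariantVector.

(* Transition probabilities from [a'] into [Q] for the time-reversed chain. *)
Definition backward_weight {R : realType} {A : pointedFinType}
    (p : A -> R) (P : A -> A -> R) (Q : pred A) (a' : A) : R :=
  \sum_(a | Q a) p a * P a a' / p a'.

(** * The transition weights of the reversed chain *)

Section BackwardWeight.
Context {R : realType} {A : pointedFinType}.
Context (P : A -> A -> R) (p : A -> R).
Hypotheses (P_ge0 : forall i j, 0 <= P i j) (p_gt0 : forall a, 0 < p a).
Hypothesis (p_inv : invariant_vector p P).

Let term_ge0 a a' : 0 <= p a * P a a' / p a'.
Proof. by rewrite divr_ge0 ?mulr_ge0// ltW. Qed.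

Lemma backward_weight_ge0 Q a' : 0 <= backward_weight p P Q a'.
Proof. exact: sumr_ge0. Qed.

(** Invariance of [p] is exactly what makes the reversed kernel stochastic. *)
Lemma backward_weightT a' : backward_weight p P xpredT a' = 1.
Proof.
by rewrite /backward_weight -mulr_suml p_inv divff// gt_eqF.
Qed.

Lemma backward_weightC Q a' :
  backward_weight p P (predC Q) a' = 1 - backward_weight p P Q a'.
Proof.
by rewrite -(backward_weightT a') /backward_weight (bigID Q xpredT)/= addrAC
  subrr add0r.
Qed.

Lemma backward_weight_gt0 Q a' :
  0 < backward_weight p P Q a' <-> exists2 a, Q a & 0 < P a a'.
Proof.
rewrite /backward_weight psumr_gt0P//.
split=> -[a Qa aa']; exists a => //; move: aa';
  by rewrite pmulr_lgt0 ?invr_gt0// pmulr_rgt0.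
Qed.

End BackwardWeight.

(** * The backward Markov property, stationarity and the support of the Markov measure *)

Section MarkovMeasure.
Context {R : realType} {A : pointedFinType}.
Context (P : A -> A -> R) (p : A -> R) (mu : probability (symseq A) R).
Hypotheses (P_ge0 : forall i j, 0 <= P i j) (p_gt0 : forall a, 0 < p a).
Hypotheses (p_inv : invariant_vector p P) (mu_markov : markov_measure p P mu).

Lemma markov_coord0 a : mu [set x | x 0%N = a] = (p a)%:E.
Proof.
have := mu_markov 0 (fun=> a); rewrite big_ord0 mulr1 => <-; congr (mu _).
apply/seteqP; split=> x /= x0; last exact: x0.
by move=> i; rewrite leqn0 => /eqP ->.
Qed.

Lemma markov_coord01 a a' :
  mu [set x | x 0%N = a /\ x 1%N = a'] = (p a * P a a')%:E.
Proof.
have := mu_markov 1 (fun i => if i == 0%N then a else a').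
rewrite big_ord1/= => <-; congr (mu _).
apply/seteqP; split=> x /=; first by move=> [x0 x1] [|[]].
by move=> x01; split; [exact: (x01 0%N)|exact: (x01 1%N)].
Qed.

(** Both sides are finite measures in [E]: a restriction of [mu] pushed forward by the shift, and a
    scaled restriction of [mu]. It is enough to compare them on cylinders, where the product formula
    applies. *)
Lemma markov_step a a' E : measurable E ->
  mu [set x | [/\ x 0%N = a, x 1%N = a' & E (left_shift x)]] =
  ((p a * P a a' / p a')%:E * mu (E `&` [set x | x 0%N = a']))%E.
Proof.
pose D1 := [set x : symseq A | x 0%N = a] `&` [set x | x 1%N = a'].
pose D2 := [set x : symseq A | x 0%N = a'].
have mD1 : measurable D1 by apply: measurableI; exact: measurable_coord.
have mD2 : measurable D2 by exact: measurable_coord.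
have c0 : 0 <= p a * P a a' / p a' by rewrite divr_ge0 ?mulr_ge0// ltW.
pose mf : {mfun symseq A >-> symseq A} :=
  HB.pack (@left_shift A)
    (isMeasurableFun.Build _ _ _ _ _ (@measurable_left_shift A)).
pose m1 := pushforward (mrestr mu mD1) mf.
pose m2 := mscale (NngNum c0) (mrestr mu mD2).
have m1E F : m1 F = mu (left_shift @^-1` F `&` D1) by [].
have m2E F :
  m2 F = ((p a * P a a' / p a')%:E * mu (F `&` D2))%E by [].
move=> mE; rewrite -m2E; transitivity (m1 E).
  by congr (mu _); apply/seteqP; split=> x /= => [[? ? ?]|[? [? ?]]].
apply: measure_cylinder_unique => //.
  change (m1 setT < +oo)%E; rewrite m1E preimage_setT setTI.
  by rewrite -ge0_fin_numE// fin_num_measure.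
move=> n w; change (m1 (cylinder n w) = m2 (cylinder n w)); rewrite m1E m2E.
(* A [cylinder] of length [0] fixes no letter, whereas the product formula always fixes at least
   one; the total masses are therefore compared separately. *)
case: n => [|n].
  rewrite cylinder0 preimage_setT !setTI markov_coord0.
  rewrite (_ : D1 = [set x | x 0%N = a /\ x 1%N = a'])//.
  by rewrite markov_coord01 -EFinM divfK// gt_eqF.
(* A word that does not start with [a'] makes both sets empty. *)
have [w0|w0] := eqVneq (w 0%N) a'; last first.
  have -> : left_shift @^-1` cylinder n.+1 w `&` D1 = set0.
    apply/seteqP; split=> x // [/(_ 0%N isT) x0 [_ xa]].
    by move: w0; rewrite -x0 -xa /left_shift eqxx.
  have -> : cylinder n.+1 w `&` D2 = set0.
    apply/seteqP; split=> x // [/(_ 0%N isT) x0 xa].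
    by move: w0; rewrite -x0 xa eqxx.
  by rewrite !measure0 mule0.
(* Prefixing [a] to the word adds the factor [P a a'] and replaces the initial [p a'] by [p a],
   which is the ratio on the right. *)
have -> : left_shift @^-1` cylinder n.+1 w `&` D1 =
    [set x | forall i, (i <= n.+1)%N -> x i = scons a w i].
  apply/seteqP; split=> x /=.
    by move=> [xw [xa xa']] [|i] // ilt; exact: xw.
  move=> xw; split; first by move=> i ilt; exact: (xw i.+1).
  by split; [exact: (xw 0%N)|rewrite /= (xw 1%N)].
have -> : cylinder n.+1 w `&` D2 =
    [set x | forall i, (i <= n)%N -> x i = w i].
  apply/seteqP; split=> x /=; first by move=> [].
  by move=> xw; split; [exact: xw|rewrite /D2/= xw].
rewrite !mu_markov big_ord_recl/= w0 -!EFinM; congr (_%:E).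
by rewrite !mulrA divfK// gt_eqF.
Qed.

(** Splitting the left side by the letters at places [0] and [1] and expanding the integral by
    letters reduces the claim to a double sum of instances of [markov_step]. *)
Lemma markov_backward (Q : pred A) E : measurable E ->
  mu ([set x | Q (x 0%N)] `&` left_shift @^-1` E) =
  (\int[mu]_(x in E) (backward_weight p P Q (x 0%N))%:E)%E.
Proof.
move=> mE; rewrite integral_coord//.
have mTE : measurable (left_shift @^-1` E).
  exact: measurable_preimage_left_shift.
rewrite setIC measure_coord_pred//.
under [RHS]eq_bigr => a' _.
  rewrite /backward_weight -sumEFin ge0_sume_distrl; last first.
    by move=> a _; rewrite lee_fin divr_ge0 ?mulr_ge0// ltW.
  over.
rewrite exchange_big/=; apply: eq_bigr => a _.
have mX : measurable (left_shift @^-1` E `&` [set x : symseq A | x 0%N = a]).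
  by apply: measurableI => //; exact: measurable_coord.
have := measure_coord_pred mu 1 xpredT mX.
rewrite (_ : [set _ | true] = setT) ?setIT => [->|]; last first.
  by apply/seteqP; split.
apply: eq_bigr => a' _; rewrite -markov_step//; congr (mu _).
by apply/seteqP; split=> x /= => [[[? ?] ?]|[? ? ?]].
Qed.

(** This is the backward property for the full alphabet, whose weight is [1]. *)
Lemma markov_stationary E : measurable E -> mu (left_shift @^-1` E) = mu E.
Proof.
move=> mE; have := markov_backward xpredT mE.
rewrite (_ : [set _ | _] = setT) ?setTI => [->|]; last by apply/seteqP; split.
under eq_integral do rewrite (backward_weightT p_gt0 p_inv).
by rewrite integral_cst// mul1e.
Qed.

(** The complement is the countable union of the events of a forbidden transition at time [n]. The
    event at time [0] is null because [P] vanishes there, and stationarity carries this to all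
    times. *)
Lemma markov_SFT (M : A -> A -> bool) : compatible P M -> mu (SFT M) = 1%E.
Proof.
move=> P_comp; have mM := measurable_SFT M.
pose bad n := [set x : symseq A | ~~ M (x n) (x n.+1)].
have badE n : bad n = \bigcup_(c in [set c : A * A | ~~ M c.1 c.2])
    [set x : symseq A | x n = c.1 /\ x n.+1 = c.2].
  apply/seteqP; split=> [x Mx|x [c nM [x0 x1]]]; first by exists (x n, x n.+1).
  by rewrite /bad/= x0 x1.
have m01 n (c : A * A) :
    measurable [set x : symseq A | x n = c.1 /\ x n.+1 = c.2].
  by apply: measurableI; exact: measurable_coord.
have mbad n : measurable (bad n).
  by rewrite badE; apply: fin_bigcup_measurable => //; exact: finite_finset.
have bad0 n : mu (bad n) = 0%E.
  elim: n => [|n IH]; last by rewrite -[RHS]IH -(markov_stationary (mbad n)).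
  rewrite badE measure_fin_bigcup//.
  - rewrite fsbig1// => c /= nM; rewrite markov_coord01.
    suff -> : P c.1 c.2 = 0 by rewrite mulr0.
    apply/eqP; rewrite eq_le P_ge0 andbT leNgt.
    by apply: contra nM => /P_comp.
  - exact: finite_finset.
  - move=> [c c'] [d d'] _ _ [x [[/= cx c'x] [/= dx d'x]]].
    by rewrite -cx -c'x dx d'x.
have ndM : ~` SFT M = \bigcup_n bad n.
  apply/seteqP; split=> [x /existsNP[n /negP nM]|x [n _ nM] Mx].
    by exists n.
  by move/negP: nM; exact.
rewrite -[SFT M]setCK probability_setC; last exact: measurableC.
rewrite (_ : mu _ = 0%E) ?sube0// ndM.
apply/negligibleP; first by apply: bigcupT_measurable.
apply: negligible_bigcup => n; exact: (negligibleP mu (mbad n)).2 (bad0 n).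
Qed.

End MarkovMeasure.

Lemma measure_setI_full d (T : measurableType d) (R : realType)
    (m : probability T R) (D E : set T) :
  measurable D -> measurable E -> m D = 1%E -> m (D `&` E) = m E.
Proof.
move=> mD mE mD1.
suff mED : m (E `\` D) = 0%E.
  by rewrite [RHS](measureDI m mE mD) [X in (X + _)%E]mED add0e setIC.
apply/eqP; rewrite -measure_le0.
apply: (@le_trans _ _ (m (~` D))); last by rewrite probability_setC// mD1 subee.
apply: le_measure; rewrite ?inE; [exact: measurableD|exact: measurableC|].
by move=> x [].
Qed.

(** * Averages of the reversed weights over a set of full measure *)

Section BackwardIntegral.
Context {R : realType} {A : pointedFinType}.
Context (P : A -> A -> R) (p : A -> R).
Hypotheses (P_ge0 : forall i j, 0 <= P i j) (p_gt0 : forall a, 0 < p a).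
Hypothesis p_inv : invariant_vector p P.
Context (m : probability (symseq A) R) (D : set (symseq A)).
Hypotheses (mD : measurable D) (mD1 : m D = 1%E).

Lemma Rintegral_coord (F : A -> R) :
  \int[m]_(x in D) F (x 0%N) =
  \sum_a F a * fine (m (D `&` [set x | x 0%N = a])).
Proof.
rewrite /Rintegral integral_coord// -sum_fine => [|a _].
  apply: eq_bigr => a _; rewrite fineM// fin_num_measure//.
  by apply: measurableI => //; exact: measurable_coord.
rewrite fin_numM// fin_num_measure//.
by apply: measurableI => //; exact: measurable_coord.
Qed.

(** With [m] the measure [mu_ y], [D] the fibre over [y] and [Q] the letters over [b], this is
    [gtilde] at [scons b y]. *)
Definition backward_integral (Q : pred A) : R :=
  \int[m]_(x in D) backward_weight p P Q (x 0%N).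

Lemma backward_integral_ge0 Q : 0 <= backward_integral Q.
Proof. by apply: Rintegral_ge0 => x _; exact: backward_weight_ge0. Qed.

(** Integrating the constant [1] gives this; it makes [backward_integral] a convex combination of
    the weights. *)
Lemma sum_fine_coord :
  \sum_a fine (m (D `&` [set x | x 0%N = a])) = 1.
Proof.
have := Rintegral_coord (fun=> 1).
rewrite /Rintegral integral_cst// mul1e [X in fine X]mD1 => /= ->.
by apply: eq_bigr => a _; rewrite mul1r.
Qed.

Lemma backward_integralT : backward_integral xpredT = 1.
Proof.
rewrite /backward_integral Rintegral_coord -[RHS]sum_fine_coord.
by apply: eq_bigr => a _; rewrite (backward_weightT p_gt0 p_inv) mul1r.
Qed.

Lemma backward_integralC Q :
  backward_integral (predC Q) = 1 - backward_integral Q.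
Proof.
rewrite /backward_integral !Rintegral_coord -sum_fine_coord -sumrB.
apply: eq_bigr => a _.
by rewrite (backward_weightC p_gt0 p_inv) mulrBl mul1r.
Qed.

Lemma backward_integral_le1 Q : backward_integral Q <= 1.
Proof. by rewrite -subr_ge0 -backward_integralC backward_integral_ge0. Qed.

(** The preimages of the letters [b] partition [A], and the weights are additive. Normalization of
    [gtilde] rests on this. *)
Lemma sum_backward_integral (B : finType) (pi : A -> B) :
  \sum_b backward_integral (fun a => pi a == b) = 1.
Proof.
rewrite -backward_integralT /backward_integral.
under eq_bigr do rewrite Rintegral_coord.
rewrite Rintegral_coord exchange_big/=; apply: eq_bigr => a' _.
rewrite -mulr_suml; congr (_ * _).
by rewrite [in RHS]/backward_weight (partition_big pi xpredT).
Qed.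

(** A finite sum of nonnegative products is positive exactly when some letter has both positive
    weight and positive mass. *)
Lemma backward_integral_gt0 Q :
  0 < backward_integral Q <->
  (0 < m (D `&` [set x | exists2 a, Q a & (0 < P a (x 0%N))%R]))%E.
Proof.
pose S : pred A := fun a' => 0 < backward_weight p P Q a'.
have SE : [set x : symseq A | exists2 a, Q a & 0 < P a (x 0%N)] =
    [set x | S (x 0%N)].
  apply/seteqP; split=> x /=; rewrite /S;
    by move=> /(backward_weight_gt0 P_ge0 p_gt0).
pose w a := fine (m (D `&` [set x | x 0%N = a])).
have w0 a : 0 <= w a by exact: fine_ge0.
rewrite SE measure_coord_pred// /backward_integral Rintegral_coord -/w.
rewrite (eq_bigr (fun a => (w a)%:E)) => [|a _]; last first.
  rewrite fineK// fin_num_measure//.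
  by apply: measurableI => //; exact: measurable_coord.
rewrite sumEFin lte_fin; have bw0 := backward_weight_ge0 P_ge0 p_gt0 Q.
have sumF := psumr_gt0P (fun a (_ : xpredT a) => mulr_ge0 (bw0 a) (w0 a)).
have sumS := psumr_gt0P (fun a (_ : S a) => w0 a).
split=> [/sumF[a _ wa]|/sumS[a Sa wa]].
  apply/sumS; exists a; rewrite /S lt_def ?bw0 ?w0 andbT.
    by apply: contraTneq wa => ->; rewrite mul0r ltxx.
  by apply: contraTneq wa => ->; rewrite mulr0 ltxx.
by apply/sumF; exists a => //; rewrite mulr_gt0.
Qed.

End BackwardIntegral.

(** * Almost sure uniqueness of conditional probabilities given the future *)

Section ConditionalProbability.
Context {R : realType} {B : pointedFinType} (nu : probability (symseq B) R).

Lemma future_measurable (C : set (symseq B)) : future_sigma C -> measurable C.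
Proof. by move=> [D mD <-]; exact: measurable_left_shift. Qed.

(** Both versions are measurable for the future sigma-algebra and have equal integrals over each of
    its sets, so they agree almost everywhere for [nu] restricted to it. *)
Lemma conditional_probability_unique (h k : B -> symseq B -> R) b :
  conditional_probability nu h -> conditional_probability nu k ->
  {ae nu, forall y, h b y = k b y}.
Proof.
pose T := g_sigma_algebra_preimageType (@left_shift B).
(* The identity into the coarser measurable space; pushing [nu] forward along it restricts [nu] to
   the future sigma-algebra. *)
pose i : symseq B -> T := idfun.
have mi : measurable_fun setT i.
  by move=> _ C mC; rewrite setTI; exact: future_measurable.
move=> /(_ b)[mh ih hE] /(_ b)[mk ik kE].
have mh' : measurable_fun setT (EFin \o (h b : T -> R)).
  apply/measurable_EFinP => _ U mU; rewrite setTI; exact: mh.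
have mk' : measurable_fun setT (EFin \o (k b : T -> R)).
  apply/measurable_EFinP => _ U mU; rewrite setTI; exact: mk.
pose mf : {mfun symseq B >-> T} :=
  HB.pack i (isMeasurableFun.Build _ _ _ _ _ mi).
have int_i (f : T -> \bar R) (C : set T) : measurable C ->
    measurable_fun setT f -> nu.-integrable setT f ->
    (\int[pushforward nu mf]_(y in C) f y =
     \int[nu]_(y in (C : set (symseq B))) f y)%E.
  move=> mC mf' intf; rewrite integral_pushforward//.
  apply: integrableS intf => //; exact: future_measurable.
have ih' : (pushforward nu mf).-integrable setT (EFin \o (h b : T -> R)).
  exact: integrable_pushforward.
have hkE (C : set T) : C `<=` setT -> measurable C ->
    (\int[pushforward nu mf]_(y in C) ((h b : T -> R) y)%:E =
     \int[pushforward nu mf]_(y in C) ((k b : T -> R) y)%:E)%E.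
  move=> _ mC; rewrite (int_i (EFin \o h b))// (int_i (EFin \o k b))//.
  by rewrite [LHS]hE// [RHS]kE.
have [N [mN nuN sub]] := integral_ae_eq measurableT ih' mk' hkE.
exists N; split=> //; first exact: future_measurable.
by move=> y /= hk; apply: sub => /= /(_ I)[].
Qed.

End ConditionalProbability.

(** * The function [gtilde] as a conditional probability of the factor measure *)

Section FactorMarkov.
Context {R : realType} {A B : pointedFinType} (pi : A -> B).
Context (M : A -> A -> bool) (M' : B -> B -> bool).
Context (P : A -> A -> R) (p : A -> R).
Context (mu : probability (symseq A) R) (nu : probability (symseq B) R).
Context (mu_ : symseq B -> probability (symseq A) R).

Let Omega := SFT M.
Let Sigma := SFT M'.
Let g := gtilde pi Omega p P mu_.

Hypothesis pi_onto : blockmap pi @` Omega = Sigma.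
Hypotheses (P_ge0 : forall i j, 0 <= P i j) (p_gt0 : forall a, 0 < p a).
Hypotheses (P_comp : compatible P M) (p_inv : invariant_vector p P).
Hypothesis mu_markov : markov_measure p P mu.
Hypothesis nu_def :
  forall E, measurable E -> nu E = pushforward mu (blockmap pi) E.
Hypothesis mu_disint : disintegration pi Omega Sigma mu nu mu_.

Let G (Q : pred A) (y : symseq B) : R :=
  backward_integral P p (mu_ y) (fibre pi Omega y) Q.
Let over (b : B) : pred A := fun a => pi a == b.

Let mOmega : measurable Omega. Proof. exact: measurable_SFT. Qed.
Let mSigma : measurable Sigma. Proof. exact: measurable_SFT. Qed.
Let mfibre y : measurable (fibre pi Omega y).
Proof. exact: measurable_fibre. Qed.
Let fibre1 y : Sigma y -> mu_ y (fibre pi Omega y) = 1%E.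
Proof. exact: mu_disint.1. Qed.

Lemma gtildeE y : g y = G (over (y 0%N)) (left_shift y).
Proof. by []. Qed.

Lemma nu_SFT : nu Sigma = 1%E.
Proof.
rewrite nu_def// /pushforward; apply/eqP; rewrite eq_le; apply/andP; split.
  apply: probability_le1; exact: measurable_preimage_blockmap.
rewrite -(markov_SFT P_ge0 p_gt0 p_inv mu_markov P_comp).
apply: le_measure; rewrite ?inE//.
  exact: measurable_preimage_blockmap.
by rewrite -pi_onto => x Mx; exists x.
Qed.

(** The measurability clause of the disintegration applies to the bounded function
    [backward_weight p P Q (x 0)]. *)
Lemma measurable_backward_integral Q : measurable_fun Sigma (G Q).
Proof.
apply: (measurableT_comp (f := fine)); first exact: fine_measurable.
apply: (mu_disint.2 (fun x => backward_weight p P Q (x 0%N)) _).1.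
exact: integrable_coord.
Qed.

(** Fibre measures are constrained only over [Sigma]. Extension by zero gives functions that are
    measurable and bounded on the whole space, as a conditional probability requires. *)
Let k b := G (over b) \_ Sigma.

Let mk b : measurable_fun setT (k b).
Proof.
exact: (measurable_restrictT _ mSigma).1 (@measurable_backward_integral _).
Qed.

Let k_ge0 b y : 0 <= k b y.
Proof.
rewrite /k patchE; case: ifPn => // /set_mem Sy.
exact: backward_integral_ge0.
Qed.

Let k_le1 b y : k b y <= 1.
Proof.
rewrite /k patchE; case: ifPn => [/set_mem Sy|_]; last exact: ler01.
exact: (backward_integral_le1 P_ge0 p_gt0 p_inv (mfibre y) (fibre1 Sy)).
Qed.

Let gk y : Sigma y -> g y = k (y 0%N) (left_shift y).
Proof.
move=> Sy; rewrite gtildeE /k patchE mem_set//; exact: SFT_left_shift.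
Qed.

Lemma measurable_gtilde : measurable_fun Sigma g.
Proof.
move=> _ Y mY.
rewrite (_ : _ `&` _ = Sigma `&` \bigcup_b
    ([set y : symseq B | y 0%N = b] `&` (k b \o left_shift) @^-1` Y)).
  apply: measurableI => //; apply: fin_bigcup_measurable => [|b _].
    exact: finite_finset.
  apply: measurableI; first exact: measurable_coord.
  rewrite -[X in measurable X]setTI.
  by apply: measurableT_comp => //; exact: measurable_left_shift.
apply/seteqP; split=> y [Sy]; rewrite /= gk//.
  by move=> Yy; split=> //; exists (y 0%N).
by move=> [b _ [<- Yy]].
Qed.

(** The block map commutes with the shift, so stationarity passes from [mu] to its image. *)
Lemma nu_stationary E : measurable E -> nu (left_shift @^-1` E) = nu E.
Proof.
move=> mE; rewrite !nu_def//; last exact: measurable_preimage_left_shift.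
apply: (markov_stationary P_ge0 p_gt0 p_inv mu_markov).
exact: measurable_preimage_blockmap.
Qed.

Lemma integral_left_shift (f : symseq B -> \bar R) D :
  measurable D -> measurable_fun D f -> (forall y, 0 <= f y)%E ->
  (\int[nu]_(y in left_shift @^-1` D) f (left_shift y) =
   \int[nu]_(y in D) f y)%E.
Proof.
move=> mD mf f0.
pose T : {mfun symseq B >-> symseq B} :=
  HB.pack (@left_shift B)
    (isMeasurableFun.Build _ _ _ _ _ (@measurable_left_shift B)).
rewrite -(@ge0_integral_pushforward _ _ _ _ _ T
  (@measurable_left_shift B) nu)//.
by apply: eq_measure_integral => E mE _; exact: nu_stationary.
Qed.

(** The weight cut off to the preimage of [D] is disintegrated along [pi]; the backward Markov
    property then evaluates its integral against [mu]. *)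
Lemma backward_integral_disintegration Q D : measurable D ->
  (\int[nu]_(y in Sigma `&` D) (G Q y)%:E =
   mu ([set x | Q (x 0%N)] `&`
       left_shift @^-1` (blockmap pi @^-1` D)))%E.
Proof.
move=> mD.
have mpD : measurable (blockmap pi @^-1` D).
  exact: measurable_preimage_blockmap.
pose F (x : symseq A) := backward_weight p P Q (x 0%N).
pose f := F \_ (blockmap pi @^-1` D).
have intf : mu.-integrable Omega (EFin \o f).
  rewrite -restrict_EFin; apply/integrable_restrict => //.
  by apply: integrable_coord; exact: measurableI.
rewrite integral_mkcondr (markov_backward P_ge0 p_gt0 mu_markov)//.
transitivity (\int[nu]_(y in Sigma)
    \int[mu_ y]_(x in fibre pi Omega y) (f x)%:E)%E.
  apply: eq_integral => y /set_mem Sy; rewrite patchE.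
  (* The cutoff is constant on each fibre, so it leaves the inner integral and becomes a restriction
     of [y] to [D]. *)
  have fE x : fibre pi Omega y x -> f x = if y \in D then F x else 0.
    move=> [_ xy]; rewrite /f patchE; congr (if _ then _ else _).
    by rewrite -xy; apply/idP/idP => /set_mem Dx; exact/mem_set.
  case: ifPn => yD.
    rewrite /G /backward_integral /Rintegral fineK; last first.
      by apply: integrable_fin_num => //; exact: integrable_coord.
    by apply: eq_integral => x /set_mem /fE; rewrite yD => ->.
  rewrite integral0_eq// => x /fE; rewrite (negbTE yD) => ->//.
rewrite -(mu_disint.2 f intf).2.
transitivity
    (\int[mu]_(x in Omega) ((EFin \o F) \_ (blockmap pi @^-1` D)) x)%E.
  by apply: eq_integral => x _; rewrite restrict_EFin.
(* Expanding both integrals by letters leaves only the removal of [Omega], which has full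
   measure. *)
rewrite -integral_mkcondr !integral_coord//; last exact: measurableI.
apply: eq_bigr => a _; congr (_ * _)%E; rewrite -setIA.
apply: measure_setI_full => //.
  by apply: measurableI => //; exact: measurable_coord.
exact: (markov_SFT P_ge0 p_gt0 p_inv mu_markov P_comp).
Qed.

Lemma conditional_probability_backward :
  conditional_probability nu (fun b => k b \o left_shift).
Proof.
move=> b; split.
- move=> U mU; exists (k b @^-1` U); rewrite ?setTI//.
  by rewrite -[X in measurable X]setTI; exact: mk.
- apply: measurable_bounded_integrable => //.
  + by rewrite -ge0_fin_numE// fin_num_measure.
  + by apply: measurableT_comp => //; exact: measurable_left_shift.
  + exists 1; split; first exact: num_real.
    by move=> c /ltW c1 y _ /=; apply: le_trans c1; rewrite ger0_norm.
- move=> _ [D mD <-]; rewrite setTI.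
  have mkD : measurable_fun D (EFin \o k b).
    by apply/measurable_EFinP; exact: measurable_funTS.
  (* A future event is a shift preimage, so invariance of [nu] removes the shift from both the
     domain and the integrand. *)
  rewrite (integral_left_shift mD mkD); last by move=> y; rewrite lee_fin.
  rewrite (eq_integral ((EFin \o G (over b)) \_ Sigma)); last first.
    by move=> y _; rewrite restrict_EFin.
  rewrite -integral_mkcondr setIC backward_integral_disintegration//.
  rewrite nu_def; last first.
    apply: measurableI; first exact: measurable_coord.
    exact: measurable_preimage_left_shift.
  by congr (mu _); apply/seteqP; split=> x [/eqP ? ?].
Qed.

Lemma ae_SFT : {ae nu, forall y, Sigma y}.
Proof.
exists (~` Sigma); split=> //; first exact: measurableC.
by rewrite probability_setC// nu_SFT subee.
Qed.

(** For each [b], the zero set [Z] of the conditional probability is a future event, so the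
    [nu]-mass of [y 0 = b] within [Z] is an integral of zero. Finitely many [b] give one null
    set. *)
Lemma gtilde_gt0_ae : {ae nu, forall y, 0 < g y}.
Proof.
have pos b : {ae nu, forall y, y 0%N = b -> 0 < k b (left_shift y)}.
  pose Z := left_shift @^-1` (k b @^-1` [set 0]).
  have fZ : future_sigma Z.
    exists (k b @^-1` [set 0]); rewrite ?setTI//.
    by rewrite -[X in measurable X]setTI; exact: mk.
  exists ([set y | y 0%N = b] `&` Z); split.
  + apply: measurableI; first exact: measurable_coord.
    exact: future_measurable.
  + have [_ _ <-//] := conditional_probability_backward b.
    by rewrite integral0_eq// => y /= ->.
  + move=> y /= /not_implyP[yb /negP]; rewrite -leNgt => ky.
    by split=> //; apply/eqP; rewrite eq_le ky k_ge0.
apply: (filterS2 _ _ ae_SFT (filter_forall _ pos)) => y Sy posy.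
by rewrite gk// posy.
Qed.

(** Uniqueness holds almost everywhere for every [b] simultaneously because [B] is finite; it is
    then evaluated at [b = y 0]. *)
Lemma consistent_gtilde : consistent nu g.
Proof.
have ck := conditional_probability_backward.
split; first by exists (fun b => k b \o left_shift).
move=> h ch.
have uniq b := conditional_probability_unique b ch ck.
apply: (filterS2 _ _ ae_SFT (filter_forall _ uniq)) => y Sy hk.
by rewrite hk gk.
Qed.

(** The sum over all of [B] is [1], and an inadmissible [b] contributes zero: a positive term would
    provide [x] over [y] and [a] over [b] with [scons a x] in [Omega], whose image is
    [scons b y]. *)
Lemma normalized_gtilde : normalized Sigma g.
Proof.
move=> y Sy.
rewrite -[RHS](sum_backward_integral p_gt0 p_inv (mfibre y) (fibre1 Sy) pi).
rewrite [LHS]big_mkcond; apply: eq_bigr => b _.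
case: ifPn => [//|/asboolPn nby].
apply/esym/eqP; rewrite eq_le backward_integral_ge0// andbT leNgt; apply/negP.
move=> /(backward_integral_gt0 P_ge0 p_gt0 (mu_ y) (mfibre y)).
rewrite (_ : _ `&` _ = set0) ?measure0 ?ltxx//.
apply/seteqP; split=> x // -[[Mx xy] [a /eqP ab /P_comp Max]].
apply: nby; rewrite -pi_onto; exists (scons a x).
  by case=> [|n] //=; exact: Mx.
by apply/funext => -[|n] //=; rewrite -xy.
Qed.

(** On the fibre over [left_shift y] the letter [x 0] lies over [y 1], so other letters have no
    mass; full mass of the fibre lets [Omega] replace it in the measured sets. *)
Lemma gtilde_sum y : Sigma y ->
  g y = \sum_(a' | pi a' == y 1%N)
          (\sum_(a | pi a == y 0%N) p a * P a a' / p a') *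
          fine (mu_ (left_shift y) [set w | Omega w /\ w 0%N = a']).
Proof.
move=> Sy; have STy : Sigma (left_shift y) by exact: SFT_left_shift.
rewrite gtildeE /G /backward_integral Rintegral_coord// [RHS]big_mkcond/=.
apply: eq_bigr => a' _; case: ifPn => [/eqP a'y|a'y].
  congr (_ * fine _).
  rewrite -[RHS](measure_setI_full (mfibre _) _ (fibre1 STy)).
    congr (mu_ _ _); apply/seteqP; split=> x.
      by move=> [[Mx xy] x0].
    by move=> [xy [_ x0]].
  by apply: measurableI => //; exact: measurable_coord.
rewrite (_ : _ `&` _ = set0) ?measure0 ?mulr0//.
apply/seteqP; split=> x // -[[_ xy] x0]; move/eqP: a'y; apply.
by rewrite -x0 -[RHS]/(left_shift y 0%N) -xy.
Qed.

Lemma gtilde_bounds y : Sigma y -> 0 <= g y <= 1.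
Proof. by move=> Sy; rewrite gk// k_ge0 k_le1. Qed.

(** The disintegration identity does not see [mu_] over a [nu]-null set of points, so positivity at
    a given point is expressed through the fibre measure there. *)
Lemma gtilde_gt0 y :
  0 < g y <->
  (0 < mu_ (left_shift y) [set w | fibre pi Omega (left_shift y) w /\
                           exists2 a, pi a = y 0%N & M a (w 0%N)])%E.
Proof.
rewrite gtildeE /G backward_integral_gt0//.
rewrite (_ : _ `&` _ = [set w | fibre pi Omega (left_shift y) w /\
                           exists2 a, pi a = y 0%N & M a (w 0%N)])//.
by apply/seteqP; split=> w [fw [a] /eqP ay /P_comp Ma]; split=> //; exists a.
Qed.

(** [1 - g y] is the backward integral over the letters not above [y 0], so the positivity criterion
    applies to the complementary predicate. *)
Lemma gtilde_lt1 y : Sigma y ->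
  g y < 1 <->
  (0 < mu_ (left_shift y) [set w | fibre pi Omega (left_shift y) w /\
                           exists2 a, pi a <> y 0%N & M a (w 0%N)])%E.
Proof.
move=> Sy; have STy : Sigma (left_shift y) by exact: SFT_left_shift.
rewrite gtildeE -subr_gt0 /G.
rewrite -(backward_integralC p_gt0 p_inv (mfibre _) (fibre1 STy)).
rewrite backward_integral_gt0//.
rewrite (_ : _ `&` _ = [set w | fibre pi Omega (left_shift y) w /\
                           exists2 a, pi a <> y 0%N & M a (w 0%N)])//.
by apply/seteqP; split=> w [fw [a] /eqP ay /P_comp Ma]; split=> //; exists a.
Qed.

End FactorMarkov.

Theorem theorem3p2 (R : realType) (A B : pointedFinType)
  (hAB : (#|B| < #|A|)%N)
  (pi : A -> B) (pi_surj : forall b, exists a, pi a = b)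
  (M : A -> A -> bool) (M' : B -> B -> bool)
  (M_irr : irreducible_SFT M) (M'_irr : irreducible_SFT M')
  (pi_onto : blockmap pi @` SFT M = SFT M')
  (P : A -> A -> R) (P_stoch : stochastic_matrix P)
  (P_irr : irreducible_matrix P) (P_comp : compatible P M)
  (p : A -> R) (p_distr : distribution_vector p) (p_inv : invariant_vector p P)
  (mu : probability (symseq A) R) (mu_markov : markov_measure p P mu)
  (nu : probability (symseq B) R)
  (nu_def : forall E, measurable E -> nu E = pushforward mu (blockmap pi) E)
  (mu_ : symseq B -> probability (symseq A) R)
  (mu_disint : disintegration pi (SFT M) (SFT M') mu nu mu_) :
  let Omega := SFT M in
  let Sigma := SFT M' in
  let g := gtilde pi Omega p P mu_ in
  measurable_fun Sigma g /\
  (forall y, Sigma y -> 0 <= g y <= 1) /\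
  {ae nu, forall y, 0 < g y} /\
  (forall y, Sigma y ->
    (0 < g y <->
     (0 < mu_ (left_shift y) [set w | fibre pi Omega (left_shift y) w /\
                           exists2 a, pi a = y 0%N & M a (w 0%N)])%E) /\
    (g y < 1 <->
     (0 < mu_ (left_shift y) [set w | fibre pi Omega (left_shift y) w /\
                           exists2 a, pi a <> y 0%N & M a (w 0%N)])%E)) /\
  normalized Sigma g /\
  (forall y, Sigma y ->
    g y = \sum_(a' | pi a' == y 1%N)
            (\sum_(a | pi a == y 0%N) p a * P a a' / p a') *
            fine (mu_ (left_shift y) [set w | Omega w /\ w 0%N = a'])) /\
  consistent nu g.
Proof.
have P_ge0 i j : 0 <= P i j by have [+ _] := P_stoch i; exact.
have p_gt0 := invariant_vector_gt0 P_stoch P_irr p_distr p_inv.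
move=> Omega Sigma g; split.
  by apply: measurable_gtilde; exact: mu_disint.
split.
  by apply: gtilde_bounds; last exact: mu_disint.
split.
  exact: (gtilde_gt0_ae pi_onto P_ge0 p_gt0 P_comp p_inv
  mu_markov nu_def mu_disint).
split.
  move=> y Sy; split.
    by apply: gtilde_gt0.
  by apply: gtilde_lt1 Sy; last exact: mu_disint.
split; first by apply: normalized_gtilde; last exact: mu_disint.
split; first by move=> y Sy; apply: gtilde_sum Sy; last exact: mu_disint.
exact: (consistent_gtilde pi_onto P_ge0 p_gt0 P_comp p_inv
  mu_markov nu_def mu_disint).
Qed.
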